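(* Let $n_A,n_B\ge 1$ be integers and consider a bipartite quantum system with Hilbert space $\mathbb{C}^{n_A}\otimes\mathbb{C}^{n_B}$. Let $\mathcal{R}(\mathrm{LO})$ denote the data hiding ratio associated with the set $\mathrm{LO}$ of local measurements. Then $$\mathcal{R}(\mathrm{LO})\le 2\sqrt{2}\,\min\{n_A,n_B\}.$$
   Context: A measurement on a finite-dimensional Hilbert space $\mathcal{H}$ is a finite family $(e_i)_{i\in I}$ of positive semidefinite operators on $\mathcal{H}$ with $\sum_{i\in I}e_i=1$. Write $\mathbf{M}_A$, $\mathbf{M}_B$, $\mathbf{M}_{AB}$ for the sets of all measurements on $\mathcal{H}_A=\mathbb{C}^{n_A}$, $\mathcal{H}_B=\mathbb{C}^{n_B}$ and $\mathcal{H}_A\otimes\mathcal{H}_B$ respectively. Let $\mathrm{ALL}=\mathbf{M}_{AB}$, and let $$\mathrm{LO}=\left\{(e_i\otimes f_j)_{(i,j)\in I\times J}:\ (e_i)_{i\in I}\in\mathbf{M}_A,\ (f_j)_{j\in J}\in\mathbf{M}_B\right\}.$$ For a set $\mathcal{M}\subseteq \mathbf{M}_{AB}$ of measurements and a selfadjoint operator $x$ on $\mathcal{H}_A\otimes\mathcal{H}_B$, the distinguishability norm is $$\|x\|_{\mathcal{M}}=\sup_{(e_i)_{i\in I}\in\mathcal{M}}\ \sum_{i\in I}|\operatorname{tr}(e_ix)|.$$ For $\mathcal{M}=\mathrm{ALL}$ and $\mathcal{M}=\mathrm{LO}$ this is a norm on the real vector space of selfadjoint operators. The data hiding ratio is $$\mathcal{R}(\mathcal{M})=\sup_{\rho,\sigma,p}\frac{\|p\rho-(1-p)\sigma\|_{\mathrm{ALL}}}{\|p\rho-(1-p)\sigma\|_{\mathcal{M}}},$$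 where the supremum is over all pairs of states (positive semidefinite operators of trace one) $\rho,\sigma$ on $\mathcal{H}_A\otimes\mathcal{H}_B$ and all $p\in(0,1)$ such that $p\rho-(1-p)\sigma\neq 0$. *)

(* Defs.v *)
From HB Require Import structures.
From mathcomp Require Import all_boot all_order all_algebra.
From mathcomp Require Import sesquilinear spectral complex mxtens.
From mathcomp Require Import classical_sets reals constructive_ereal ereal.

Set Implicit Arguments.
Unset Strict Implicit.
Unset Printing Implicit Defensive.

Import Order.TTheory GRing.Theory Num.Theory.

Local Open Scope classical_set_scope.
Local Open Scope complex_scope.
Local Open Scope sesquilinear_scope.
Local Open Scope ring_scope.

(* Operators on C^d are d x d matrices over R[i] acting on column vectors;
   C^nA (x) C^nB is identified with C^(nA * nB) via the Kronecker product
   A *t B.  The order on R[i] is partial: 0 <= z means that z is real and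
   nonnegative. *)
Definition psd (R : realType) (d : nat) (A : 'M[R[i]]_d) : Prop :=
  A \is hermsymmx /\ forall v : 'cV[R[i]]_d, 0 <= (v^t* *m A *m v) 0 0.

Record opfamily (R : realType) (d : nat) := OpFamily {
  opidx : finType;
  op :> opidx -> 'M[R[i]]_d }.

(* Sets of families are plain predicates opfamily R d -> Prop: the type
   set (opfamily R d) is ruled out by a universe inconsistency, because
   opfamily quantifies over all finite index types. *)
Definition is_measurement (R : realType) (d : nat) (e : opfamily R d) : Prop :=
  (forall i, psd (e i)) /\ \sum_i e i = 1%:M.

Definition ALL (R : realType) (d : nat) (e : opfamily R d) : Prop :=
  is_measurement e.

Definition tens_family (R : realType) (nA nB : nat)
    (e : opfamily R nA) (f : opfamily R nB) : opfamily R (nA * nB) :=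
  OpFamily (fun ij : opidx e * opidx f => e ij.1 *t f ij.2).

Definition LO (R : realType) (nA nB : nat) (g : opfamily R (nA * nB)) : Prop :=
  exists e : opfamily R nA, exists f : opfamily R nB,
    [/\ is_measurement e, is_measurement f & g = tens_family e f].

(* Normc.normc is the modulus with values in R, whereas `|z| lives in R[i]. *)
Definition dist_norm (R : realType) (d : nat) (M : opfamily R d -> Prop)
    (x : 'M[R[i]]_d) : \bar R :=
  ereal_sup [set r | exists e : opfamily R d,
    M e /\ r = (\sum_i Normc.normc (\tr (e i *m x)))%:E].

Definition is_state (R : realType) (d : nat) (rho : 'M[R[i]]_d) : Prop :=
  psd rho /\ \tr rho = 1.

(* Division in \bar R is total with 0^-1 = +oo, so a vanishing denominator
   would make the ratio infinite. *)
Definition data_hiding_ratio (R : realType) (d : nat)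
    (M : opfamily R d -> Prop) : \bar R :=
  ereal_sup [set r | exists rho sigma : 'M[R[i]]_d, exists p : R,
    let x := p%:C *: rho - (1 - p)%:C *: sigma in
    [/\ is_state rho, is_state sigma, 0 < p < 1, x != 0
      & r = (dist_norm (@ALL R d) x / dist_norm M x)%E]].

(* Main.v *)
Require Import Defs.
From HB Require Import structures.
From mathcomp Require Import all_boot all_order all_algebra all_fingroup.
From mathcomp Require Import sesquilinear spectral complex mxtens.
From mathcomp Require Import classical_sets reals constructive_ereal ereal.
From mathcomp Require Import ring.

(* Let x be an operator on C^n (x) C^m and let L = ||x||_LO.  A product a (x) b
   of two unitaries (or contractions) is a combination, with unimodular
   coefficients, of the effects of a local measurement, so that
   |tr ((a (x) b) x)| <= L.  Write a contraction s as sum_kl E_kl (x) s_kl and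
   put a_kl = s_kl / sqrt n, so that sum a_kl^* a_kl <= 1 and
   sum a_kl a_kl^* <= 1.  For independent uniform 4-th roots of unity e_kl, let
   t = sum conj(e_kl) a_kl be the random operator on the second factor, and let
   V be a truncation of the random matrix (e_kl / sqrt n) to a contraction.  By
   symmetry s is a multiple of the expectation of V (x) t.  As in Haagerup's and
   Musat's proof of the noncommutative Khintchine inequality, the fourth moment
   bound E (t^* t)^2 <= 2 makes truncating t to a contraction F cost only an
   error of the same form as s, of half the size.  Iterating, s is a
   combination of the V (x) F of total weight 2 sqrt 2 n.  Both truncations use
   the Cayley-type map a |-> 2 a (1 + a^* a)^-1.  Exchanging the two factors
   gives the minimum of the two dimensions. *)

Set Implicit Arguments.
Unset Strict Implicit.
Unset Printing Implicit Defensive.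

Import Order.TTheory GRing.Theory Num.Theory.

Local Open Scope sesquilinear_scope.
Local Open Scope ring_scope.

Lemma le_of_eq disp (T : porderType disp) (x y : T) : x = y -> (x <= y)%O.
Proof. by move=> ->. Qed.

(** * Hilbert-Schmidt inner product of complex matrices *)

Section HilbertSchmidt.
Variable C : numClosedFieldType.
Implicit Types (m n p q : nat).

Lemma trmxCD m n (A B : 'M[C]_(m, n)) : (A + B)^t* = A^t* + B^t*.
Proof. by rewrite linearD /= map_mxD. Qed.

Lemma trmxCN m n (A : 'M[C]_(m, n)) : (- A)^t* = - A^t*.
Proof. by rewrite linearN /= map_mxN. Qed.

Lemma trmxCZ m n c (A : 'M[C]_(m, n)) : (c *: A)^t* = c^* *: A^t*.
Proof. by rewrite linearZ /= map_mxZ. Qed.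

Lemma trmxCM m n p (A : 'M[C]_(m, n)) (B : 'M[C]_(n, p)) :
  (A *m B)^t* = B^t* *m A^t*.
Proof. by rewrite trmx_mul map_mxM. Qed.

Lemma trmxC1 n : (1%:M : 'M[C]_n)^t* = 1%:M.
Proof. by rewrite trmx1 map_mx1. Qed.

Lemma trmxC_sum m n (I : finType) (P : pred I) (F : I -> 'M[C]_(m, n)) :
  (\sum_(i | P i) F i)^t* = \sum_(i | P i) (F i)^t*.
Proof. by rewrite linear_sum /= map_mx_sum. Qed.

Lemma trmxC_inv n (A : 'M[C]_n) : (invmx A)^t* = invmx (A^t*).
Proof. by rewrite trmx_inv map_invmx. Qed.

Definition dot m n (X Y : 'M[C]_(m, n)) : C := \tr (X^t* *m Y).
Definition sqn m n (X : 'M[C]_(m, n)) : C := dot X X.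

Lemma dotDr m n (X Y Z : 'M[C]_(m, n)) : dot X (Y + Z) = dot X Y + dot X Z.
Proof. by rewrite /dot mulmxDr mxtraceD. Qed.

Lemma dotZr m n c (X Y : 'M[C]_(m, n)) : dot X (c *: Y) = c * dot X Y.
Proof. by rewrite /dot -scalemxAr mxtraceZ. Qed.

Lemma dot_conj m n (X Y : 'M[C]_(m, n)) : dot Y X = (dot X Y)^*.
Proof.
rewrite /dot -[X in _ = X](trace_map_mx Num.conj) -[RHS]mxtrace_tr.
by rewrite map_trmx trmxCM trmxCK.
Qed.

Lemma dotDl m n (X Y Z : 'M[C]_(m, n)) : dot (X + Y) Z = dot X Z + dot Y Z.
Proof. by rewrite /dot trmxCD mulmxDl mxtraceD. Qed.

Lemma dotZl m n c (X Y : 'M[C]_(m, n)) : dot (c *: X) Y = c^* * dot X Y.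
Proof. by rewrite /dot trmxCZ -scalemxAl mxtraceZ. Qed.

Lemma dotNr m n (X Y : 'M[C]_(m, n)) : dot X (- Y) = - dot X Y.
Proof. by rewrite -scaleN1r dotZr mulN1r. Qed.

Lemma dotNl m n (X Y : 'M[C]_(m, n)) : dot (- X) Y = - dot X Y.
Proof. by rewrite /dot trmxCN mulNmx raddfN. Qed.

Lemma dot_sumr m n (I : finType) (P : pred I) (X : 'M[C]_(m, n))
    (F : I -> 'M[C]_(m, n)) :
  dot X (\sum_(i | P i) F i) = \sum_(i | P i) dot X (F i).
Proof. by rewrite /dot mulmx_sumr raddf_sum. Qed.

Lemma dot_suml m n (I : finType) (P : pred I) (X : 'M[C]_(m, n))
    (F : I -> 'M[C]_(m, n)) :
  dot (\sum_(i | P i) F i) X = \sum_(i | P i) dot (F i) X.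
Proof. by rewrite /dot trmxC_sum mulmx_suml raddf_sum. Qed.

Lemma dot_mull m n p (A : 'M[C]_(m, n)) (X : 'M_(n, p)) Y :
  dot (A *m X) Y = dot X (A^t* *m Y).
Proof. by rewrite /dot trmxCM mulmxA. Qed.

Lemma sqnE m n (X : 'M[C]_(m, n)) : sqn X = \sum_j \sum_i `|X i j| ^+ 2.
Proof.
rewrite /sqn /dot /mxtrace; apply: eq_bigr => j _; rewrite mxE.
by apply: eq_bigr => i _; rewrite !mxE normCKC.
Qed.

Lemma sqn_ge0 m n (X : 'M[C]_(m, n)) : 0 <= sqn X.
Proof. by rewrite sqnE; do 2!apply: sumr_ge0 => ? _; rewrite exprn_ge0. Qed.

Lemma sqn_eq0 m n (X : 'M[C]_(m, n)) : sqn X = 0 -> X = 0.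
Proof.
rewrite sqnE => /eqP; rewrite psumr_eq0; last first.
  by move=> j _; apply: sumr_ge0 => i _; rewrite exprn_ge0.
move=> /allP h; apply/matrixP => i j; rewrite mxE.
have := h j (mem_index_enum _); rewrite /= psumr_eq0; last first.
  by move=> k _; rewrite exprn_ge0.
move=> /allP /(_ i (mem_index_enum _)) /=.
by rewrite expf_eq0 /= normr_eq0 => /eqP.
Qed.

Lemma sqnZ m n c (X : 'M[C]_(m, n)) : sqn (c *: X) = `|c| ^+ 2 * sqn X.
Proof. by rewrite /sqn dotZl dotZr mulrA normCKC. Qed.

Lemma sqn1 n : sqn (1%:M : 'M[C]_n) = n%:R.
Proof. by rewrite /sqn /dot trmxC1 mul1mx mxtrace1. Qed.

Lemma dot_young m n (X Y : 'M[C]_(m, n)) : dot X Y + dot Y X <= sqn X + sqn Y.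
Proof.
rewrite -subr_ge0; apply: le_trans (sqn_ge0 (X - Y)) _.
by rewrite /sqn dotDl !dotDr !dotNl !dotNr; apply: le_of_eq; ring.
Qed.

End HilbertSchmidt.

(** * Cayley-type truncation of a matrix to a contraction *)

Section Cayley.
Variable C : numClosedFieldType.
Implicit Types (m n p : nat).

Definition gram m (a : 'M[C]_m) : 'M[C]_m := a^t* *m a.

Lemma gram_unit m (a : 'M[C]_m) : 1%:M + gram a \in unitmx.
Proof.
rewrite -unitmx_tr -row_free_unit; apply: inj_row_free => v hv.
have {}hv : (1%:M + gram a) *m v^T = 0.
  by apply: trmx_inj; rewrite trmx_mul trmxK trmx0.
have := congr1 (dot v^T) hv; rewrite mulmxDl mul1mx dotDr -mulmxA.
rewrite /dot mulmx0 mxtrace0 mulmxA -trmxCM => /eqP.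
rewrite paddr_eq0 ?(sqn_ge0 (a *m v^T)) ?(sqn_ge0 v^T) // => /andP[/eqP].
by move=> /sqn_eq0 h _; apply: trmx_inj; rewrite h trmx0.
Qed.

(** With [h = gram a], the difference of the two sides is [|u - h u|^2], because
    [<u, h u> = |a u|^2]. *)
Lemma sqn_gram_young m p (a : 'M[C]_m) (u : 'M[C]_(m, p)) :
  4 * sqn (a *m u) <= sqn (u + gram a *m u).
Proof.
have e1 : dot u (gram a *m u) = sqn (a *m u).
  by rewrite /sqn dot_mull /gram mulmxA.
have e2 : dot (gram a *m u) u = sqn (a *m u).
  by rewrite dot_conj e1 -dot_conj.
rewrite -subr_ge0; apply: le_trans (sqn_ge0 (u - gram a *m u)) _.
rewrite /sqn !dotDl !dotDr !dotNl !dotNr e1 e2.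
by apply: le_of_eq; rewrite /sqn; ring.
Qed.

(** On singular values this is [t |-> 2 t / (1 + t ^ 2)], which takes values in [[0, 1]] and is
    [2 t] to first order at 0. *)
Definition cay m (a : 'M[C]_m) : 'M[C]_m := 2 *: (a *m invmx (1%:M + gram a)).

Lemma gram_inv_vec m p (a : 'M[C]_m) (v : 'M[C]_(m, p)) :
  exists2 u, v = u + gram a *m u & invmx (1%:M + gram a) *m v = u.
Proof.
exists (invmx (1%:M + gram a) *m v) => //.
by rewrite -{1}[X in X + _]mul1mx -mulmxDl mulKVmx // gram_unit.
Qed.

Lemma sqn_cay m p (a : 'M[C]_m) (v : 'M[C]_(m, p)) : sqn (cay a *m v) <= sqn v.
Proof.
have [u -> hu] := gram_inv_vec a v.
rewrite /cay -scalemxAl -mulmxA.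
have [w -> ->] := gram_inv_vec a (u + gram a *m u).
rewrite sqnZ normr_nat -natrX; exact: sqn_gram_young.
Qed.

(** For [v = u + h u] with [h = gram a], the residual sends [v] to [2 a h u], and [sqn_gram_young]
    applies to [h u]. *)
Lemma sqn_cay_resid m p (a : 'M[C]_m) (v : 'M[C]_(m, p)) :
  sqn ((2 *: a - cay a) *m v) <= sqn (gram a *m v).
Proof.
rewrite /cay -scalerBr -scalemxAl mulmxBl -mulmxA.
have [u -> ->] := gram_inv_vec a v.
rewrite [a *m (_ + _)]mulmxDr addrC addKr sqnZ normr_nat -natrX mulmxDr.
exact: sqn_gram_young.
Qed.

Lemma trmxC_gram m (a : 'M[C]_m) : (gram a)^t* = gram a.
Proof. by rewrite /gram trmxCM trmxCK. Qed.

Lemma trmxC_cay m (a : 'M[C]_m) : (cay a)^t* = cay (a^t*).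
Proof.
rewrite /cay trmxCZ conjC_nat trmxCM trmxC_inv trmxCD trmxC1 trmxC_gram.
congr (_ *: _).
apply: (canRL (mulmxK (gram_unit _))).
rewrite -mulmxA; apply: (canLR (mulKmx (gram_unit _))).
by rewrite mulmxDl mulmxDr mulmx1 mul1mx /gram trmxCK mulmxA.
Qed.

(** This equivariance carries the symmetries of a random matrix over to its truncation. *)
Lemma cay_unitary m (P Q a : 'M[C]_m) : P \is unitarymx -> Q \is unitarymx ->
  cay (P *m a *m Q) = P *m cay a *m Q.
Proof.
move=> hP hQ; have uP := unitarymx_unit hP; have uQ := unitarymx_unit hQ.
rewrite /cay -scalemxAr -scalemxAl; congr (_ *: _).
apply: (canLR (mulmxK (gram_unit _))).
have -> : 1%:M + gram (P *m a *m Q) = Q^t* *m (1%:M + gram a) *m Q.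
  rewrite mulmxDr mulmxDl mulmx1 -(invmx_unitary hQ) mulVmx //; congr (_ + _).
  rewrite /gram !trmxCM -(invmx_unitary hQ) -(invmx_unitary hP) !mulmxA.
  by rewrite mulmxKV.
rewrite -(invmx_unitary hQ) !mulmxA mulmxK // mulmxKV ?gram_unit //.
Qed.

Lemma diag_mx_sandwich N m (A : 'M[C]_(N, m)) (d : 'rV[C]_N) :
  A^t* *m diag_mx d *m A = \sum_i d 0 i *: ((row i A)^t* *m row i A).
Proof.
apply/matrixP => j k; rewrite mxE summxE; apply: eq_bigr => i _.
rewrite mul_mx_diag !mxE big_ord1 !mxE; ring.
Qed.

(* [cay a] is an off-diagonal block of the unitary Cayley transform
   [(1 + X) (1 - X)^-1] of the skew-Hermitian [X = [[0, a], [- a^*, 0]]]; the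
   spectral measure of that unitary, with its two blocks swapped, compresses to
   a measurement. *)
Lemma cay_measurement m (a : 'M[C]_m) :
  exists N (z : 'I_N -> C) (B : 'I_N -> 'rV[C]_m),
    [/\ forall i, `|z i| = 1, \sum_i (B i)^t* *m B i = 1%:M
      & cay a = \sum_i z i *: ((B i)^t* *m B i)].
Proof.
pose X : 'M[C]_(m + m) := block_mx 0 a (- a^t*) 0.
have XC : X^t* = - X.
  rewrite /X tr_block_mx map_block_mx !trmx0 !map_mx0 linearN /= map_mxN.
  by rewrite trmxCK opp_block_mx oppr0 opprK.
have comm : (1%:M - X) *m (1%:M + X) = (1%:M + X) *m (1%:M - X).
  rewrite !(mulmxDr, mulmxDl, mulmx1, mul1mx, mulmxN, mulNmx).
  by rewrite !addrA subrK addrK.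
(* Both factors are invertible because their product is [1 - X ^ 2 = 1 + gram X]. *)
have uu : (1%:M - X) *m (1%:M + X) \in unitmx.
  have := gram_unit X; rewrite /gram XC mulNmx.
  rewrite !(mulmxDr, mulmxDl, mulmx1, mul1mx, mulmxN, mulNmx).
  by rewrite !addrA subrK.
have [u1 u2] : 1%:M - X \in unitmx /\ 1%:M + X \in unitmx.
  by move: uu; rewrite unitmx_mul => /andP[].
pose U := (1%:M + X) *m invmx (1%:M - X).
have Uu : U \is unitarymx.
  apply/unitarymxP; rewrite /U trmxCM trmxC_inv !trmxCD trmxCN XC opprK !trmxC1.
  have -> : (1%:M + X) *m invmx (1%:M - X) = invmx (1%:M - X) *m (1%:M + X).
    apply: (canLR (mulmxK u1)); rewrite -mulmxA -comm mulKmx //.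
  by rewrite -mulmxA mulKVmx // mulVmx.
pose S : 'M[C]_(m + m) := block_mx 0 1%:M 1%:M 0.
have Su : S \is unitarymx.
  apply/unitarymxP; rewrite /S tr_block_mx map_block_mx !trmx0 !map_mx0 !trmx1.
  rewrite !map_mx1 mulmx_block !(mulmx0, mul0mx, mulmx1, addr0, add0r).
  by rewrite -scalar_mx_block.
pose W := U *m S.
have Wu : W \is unitarymx by rewrite mul_unitarymx.
have Wn : W \is normalmx.
  apply/normalmxP; rewrite (unitarymxP Wu).
  by move: Wu; rewrite -trmxC_unitary => /unitarymxP; rewrite trmxCK => ->.
have /orthomx_spectralP := Wn.
have := spectral_unitarymx W.
move: (spectralmx W) (spectral_diag W) => P d Pu hW.
have dW : diag_mx d = P *m W *m P^t*.
  rewrite hW -(invmx_unitary Pu) !mulmxA mulmxV ?unitarymx_unit // mul1mx.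
  by rewrite mulmxK ?unitarymx_unit.
have d1 i : `|d 0 i| = 1.
  have : diag_mx d \is unitarymx.
    by rewrite dW; do 2?[apply: mul_unitarymx => //]; rewrite trmxC_unitary.
  move=> /unitarymxP /matrixP /(_ i i).
  rewrite tr_diag_mx map_diag_mx mul_diag_mx !mxE eqxx !mulr1n -normCK => /eqP.
  by rewrite sqrp_eq1 // => /eqP.
pose J : 'M[C]_(m + m, m) := col_mx 1%:M 0.
have JC : J^t* = row_mx 1%:M 0.
  by rewrite /J tr_col_mx map_row_mx trmx0 map_mx0 trmx1 map_mx1.
exists (m + m)%N, (fun i => d 0 i), (fun i => row i P *m J); split => //.
  rewrite (eq_bigr (fun i => J^t* *m ((row i P)^t* *m row i P) *m J));
    last first.
    by move=> i _; rewrite trmxCM !mulmxA.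
  rewrite -mulmx_suml -mulmx_sumr.
  have -> : \sum_i (row i P)^t* *m row i P = 1%:M.
    rewrite -(mulVmx (unitarymx_unit Pu)) (invmx_unitary Pu).
    rewrite -[X in X *m _]mulmx1 -diag_const_mx diag_mx_sandwich.
    by apply: eq_bigr => i _; rewrite mxE scale1r.
  rewrite mulmx1 JC /J mul_row_col mulmx1 mulmx0 addr0 //.
(* The last block column of [(1 - X)^-1] is [(a q, q)], and [1 + X] maps it to a column with first
   block [2 a q]. *)
have -> : cay a = J^t* *m W *m J.
  pose q := invmx (1%:M + gram a).
  rewrite /W /U /S JC /J -!mulmxA mul_block_col !(mulmx0, mul0mx, mulmx1,
    addr0).
  have -> : invmx (1%:M - X) *m col_mx 0 1%:M = col_mx (a *m q) q.
    apply: (canLR (mulKmx u1)).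
    rewrite mulmxBl mul1mx /X mul_block_col !mul0mx add0r addr0 mulNmx.
    rewrite opp_col_mx add_col_mx subrr opprK; congr col_mx.
    by rewrite mulmxA -[X in X + _]mul1mx -mulmxDl mulmxV // gram_unit.
  rewrite mulmxDl mul1mx /X mul_block_col !mul0mx add0r addr0 add_col_mx.
  by rewrite mul_row_col mul1mx mul0mx addr0 /cay -/q scaler_nat mulr2n.
rewrite hW (invmx_unitary Pu) !mulmxA -trmxCM -mulmxA diag_mx_sandwich.
by apply: eq_bigr => i _; rewrite row_mul.
Qed.
End Cayley.

(** * Averages over independent 4-th roots of unity *)

Section RandomPhases.
Variable C : numClosedFieldType.
Variable I : finType.

Local Notation Om := {ffun I -> 'Z_4}.
Implicit Types (m n p : nat) (w : Om).

(** The sample space is a finite abelian group, so translation invariance replaces independence.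
    Expectations are written as sums over [w], without the factor [1 / #|Om|]. *)
Definition phase w (i : I) : C := 'i ^+ w i.

Definition bump (x : I) : Om := [ffun y => (y == x)%:R].

Lemma phaseD w w' i : phase (w + w') i = phase w i * phase w' i.
Proof.
have i4 : ('i : C) ^+ 4 = 1.
  by rewrite (exprM _ 2 2) sqrCi sqrrN expr1n.
by rewrite /phase ffunE -exprD /= expr_mod.
Qed.

Lemma norm_phase w i : `|phase w i| = 1.
Proof. by rewrite normrX normCi expr1n. Qed.

Lemma phase_conjK w i : phase w i * (phase w i)^* = 1.
Proof. by rewrite -normCK norm_phase expr1n. Qed.

Lemma phaseN w i : phase (- w) i = (phase w i)^*.
Proof.
have := phaseD w (- w) i; rewrite subrr {1}/phase ffunE expr0 => h.
have nz : phase w i != 0 by rewrite -normr_gt0 norm_phase ltr01.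
by apply: (mulfI nz); rewrite -h phase_conjK.
Qed.

Lemma phase_bump x i : phase (bump x) i = if i == x then 'i else 1.
Proof. by rewrite /phase ffunE; case: eqP. Qed.

Lemma sum_phaseD (V : nmodType) (f : Om -> V) (t : Om) :
  \sum_(w : Om) f (w + t) = \sum_w f w.
Proof. by rewrite [RHS](reindex_inj (addIr t)). Qed.

Lemma sum_phaseN (V : nmodType) (f : Om -> V) :
  \sum_(w : Om) f (- w) = \sum_w f w.
Proof. by rewrite [RHS](reindex_inj (@oppr_inj Om)). Qed.

Lemma sum_phase_eq0 (f : Om -> C) (t : Om) c :
  (forall w, f (w + t) = c * f w) -> c != 1 -> \sum_w f w = 0.
Proof.
move=> hf c1; have := sum_phaseD f t.
under eq_bigr do rewrite hf; rewrite -mulr_sumr => /eqP.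
by rewrite -subr_eq0 -{2}[\sum_w f w]mul1r -mulrBl mulf_eq0 subr_eq0 (negPf c1)
  => /eqP.
Qed.

Lemma sum_sqn_orth m p (O K : finType) (P : pred K) (phi : K -> O -> C)
    (b : K -> 'M[C]_(m, p)) :
  {in P &, forall k l, k != l -> \sum_w (phi k w)^* * phi l w = 0} ->
  \sum_w sqn (\sum_(k | P k) phi k w *: b k)
    = \sum_(k | P k) (\sum_w `|phi k w| ^+ 2) * sqn (b k).
Proof.
move=> h0.
under eq_bigr => w _.
  rewrite /sqn dot_suml; under eq_bigr => k _.
    rewrite dot_sumr; under eq_bigr => l _ do rewrite dotZl dotZr mulrA.
    over.
  over.
rewrite exchange_big; apply: eq_bigr => k Pk.
rewrite exchange_big (bigD1 k) //= [X in _ + X]big1 ?addr0; last first.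
  move=> l /andP[Pl lk]; rewrite -mulr_suml h0 ?mul0r // eq_sym //.
by rewrite -mulr_suml; congr (_ * _); apply: eq_bigr => w _; rewrite normCKC.
Qed.

(** Bessel's inequality with matrix coefficients. Pairing [h], the combination of the conjugate
    functions with the coefficients [q k], with [g] gives the sum on the left; Young's inequality
    for [c^-1 h] and [g] then suffices. *)
Lemma bessel m p (O K : finType) (phi : K -> O -> C) (c : C)
    (g : O -> 'M[C]_(m, p)) :
  0 < c -> (forall k l, k != l -> \sum_w phi k w * (phi l w)^* = 0) ->
  (forall k, \sum_w `|phi k w| ^+ 2 <= c) ->
  \sum_k sqn (\sum_w phi k w *: g w) <= c * \sum_w sqn (g w).
Proof.
move=> c0 h0 h1; pose q k := \sum_w phi k w *: g w.
pose h (w : O) := \sum_k (phi k w)^* *: q k.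
have e1 : \sum_w dot (h w) (g w) = \sum_k sqn (q k).
  under eq_bigr => w _ do rewrite /h dot_suml.
  rewrite exchange_big; apply: eq_bigr => k _.
  rewrite /sqn {2}/q dot_sumr; apply: eq_bigr => w _.
  by rewrite dotZl dotZr conjCK.
have e2 : \sum_w dot (g w) (h w) = \sum_k sqn (q k).
  have real : (\sum_k sqn (q k))^* = \sum_k sqn (q k).
    by rewrite rmorph_sum; apply: eq_bigr => k _; rewrite /sqn /= -dot_conj.
  by rewrite -[RHS]real -e1 rmorph_sum; apply: eq_bigr => w _; rewrite dot_conj.
have e3 : \sum_w sqn (h w) <= c * \sum_k sqn (q k).
  rewrite /h (sum_sqn_orth (P := xpredT)); last first.
    by move=> k l _ _ kl; rewrite -[RHS](h0 k l kl);
      under eq_bigr do rewrite conjCK.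
  rewrite mulr_sumr; apply: ler_sum => k _; apply: ler_wpM2r;
    first exact: sqn_ge0.
  by under eq_bigr do rewrite norm_conjC; exact: h1.
have e4 : 2 * c^-1 * \sum_k sqn (q k)
    <= c^-1 ^+ 2 * \sum_w sqn (h w) + \sum_w sqn (g w).
  rewrite -mulrA mulr2n mulrDl mul1r -{1}e1 -e2 !mulr_sumr -!big_split /=.
  apply: ler_sum => w _; have := dot_young (c^-1 *: h w) (g w).
  have cr : (c^-1)^* = c^-1 by rewrite geC0_conj // invr_ge0 ltW.
  rewrite dotZl dotZr sqnZ cr.
  by have -> : `|c^-1| = c^-1 by rewrite ger0_norm // invr_ge0 ltW.
have e5 : c^-1 ^+ 2 * \sum_w sqn (h w) <= c^-1 * \sum_k sqn (q k).
  apply: le_trans (ler_wpM2l _ e3) _;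
    first by rewrite exprn_ge0 // invr_ge0 ltW.
  by rewrite mulrA expr2 -(mulrA c^-1) mulVf ?mulr1 // gt_eqF.
rewrite -ler_pdivrMl // -(lerD2l (c^-1 * \sum_k sqn (q k))).
apply: le_trans (lerD e5 (lexx _)); rewrite -mulr2n -mulr_natl mulrA; exact: e4.
Qed.

(** This is the operator inequality [sum a_i^* a_i <= 1], tested on matrices with any number of
    columns. *)
Definition contractive m (a : I -> 'M[C]_m) :=
  forall p (v : 'M[C]_(m, p)), \sum_i sqn (a i *m v) <= sqn v.

Definition phase_sum m (a : I -> 'M[C]_m) w := \sum_i phase w i *: a i.

Lemma imaginary_neq1 : ('i : C) != 1.
Proof.
apply/eqP => h; have := sqrCi C; rewrite h expr1n => /eqP.
by rewrite -subr_eq0 opprK (pnatr_eq0 C 2).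
Qed.

(* The products [conj (phase w i) * phase w j], [i != j], together with the
   constant 1, are orthogonal; this is where 4-th roots of unity work but signs
   would not. *)
Lemma sum_sqn_gram m p (a : I -> 'M[C]_m) (v : 'M[C]_(m, p)) :
  contractive a -> contractive (fun i => (a i)^t*) ->
  \sum_w sqn (gram (phase_sum a w) *m v) <= #|Om|%:R * (2 * sqn v).
Proof.
move=> ca ca'.
(* The terms [i = j] of the expanded square add up to the constant [b0], indexed by [inl tt]; the
   pairs with [i != j] are indexed by [inr]. *)
pose b0 := \sum_i (a i)^t* *m (a i *m v).
pose b (k : unit + I * I) :=
  match k with inl _ => b0 | inr ij => (a ij.1)^t* *m (a ij.2 *m v) end.
pose phi (k : unit + I * I) w : C :=
  match k with inl _ => 1 | inr ij => (phase w ij.1)^* * phase w ij.2 end.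
pose P (k : unit + I * I) :=
  match k with inl _ => true | inr ij => ij.1 != ij.2 end.
have expand w : gram (phase_sum a w) *m v = \sum_(k | P k) phi k w *: b k.
  rewrite big_sumType /= (big_pred1 tt) ?scale1r; last by case.
  rewrite /gram /phase_sum trmxC_sum -mulmxA mulmx_suml.
  transitivity (\sum_i \sum_j ((phase w i)^* * phase w j)
    *: ((a i)^t* *m (a j *m v))).
    apply: eq_bigr => i _; rewrite mulmx_suml mulmx_sumr; apply: eq_bigr => j _.
    by rewrite trmxCZ -!scalemxAl -scalemxAr scalerA.
  rewrite pair_bigA /= (bigID (fun ij => ij.1 == ij.2)) /=; congr (_ + _).
  rewrite -(pair_big_dep xpredT (fun i j => i == j)
    (fun i j => ((phase w i)^* * phase w j) *: ((a i)^t* *m (a j *m v)))) /=.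
  apply: eq_bigr => i _; rewrite (big_pred1 i); last by move=> j;
    rewrite eq_sym.
  by rewrite mulrC phase_conjK scale1r.
have m1 : (-1 : C) != 1 by rewrite eq_sym -subr_eq0 opprK (pnatr_eq0 C 2).
have -> : \sum_w sqn (gram (phase_sum a w) *m v)
  = \sum_w sqn (\sum_(k | P k) phi k w *: b k).
  by apply: eq_bigr => w _; rewrite expand.
rewrite sum_sqn_orth; last first.
  move=> k l; rewrite !unfold_in.
  case: k => [[]|[i j]]; case: l => [[]|[i' j']] //= hk hl kl.
  + apply: (sum_phase_eq0 (t := bump j')) imaginary_neq1 => w.
    by rewrite !phaseD !phase_bump (negPf hl) eqxx conjC1; ring.
  + apply: (sum_phase_eq0 (t := bump i)) imaginary_neq1 => w.
    rewrite !phaseD !phase_bump eq_sym (negPf hk) eqxx !rmorphM /= !conjCK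
      conjC1.
    by ring.
  + have [e|ne] := eqVneq i' i.
      have nj : j != j' by apply: contra kl => /eqP ->; rewrite e.
      rewrite e in hl *; apply: (sum_phase_eq0 (t := bump j')) imaginary_neq1
        => w.
      rewrite !phaseD !phase_bump (negPf hl) (negPf nj) eqxx !rmorphM /= conjC1
        ?conjCK.
      by ring.
    (* When [j' = i], the phase at [i] occurs twice and the shift contributes ['i ^ 2 = -1]. *)
    apply: (sum_phase_eq0 (t := bump i)
             (c := if j' == i then -1 else 'i)) => [w|].
      rewrite !phaseD !phase_bump (negPf ne) [j == i]eq_sym (negPf hk) eqxx.
      rewrite !rmorphM /= !conjCK conjC1.
      by case: ifP => _; rewrite -?(sqrCi C); ring.
    by case: ifP => _ //; exact: imaginary_neq1.
rewrite (eq_bigr (fun k => #|Om|%:R * sqn (b k))); last first.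
  move=> k _; rewrite (eq_bigr (fun=> 1)) ?sumr_const // => w _.
  case: k => [u|[i j]] /=; first by rewrite normr1 expr1n.
  by rewrite normrM norm_conjC !norm_phase mulr1 expr1n.
rewrite -mulr_sumr; apply: ler_wpM2l; first exact: ler0n.
rewrite big_sumType /= (big_pred1 tt) /=; last by case.
rewrite mulr2n mulrDl mul1r; apply: lerD.
  (* Since [|b0|^2] is the sum of the [<a_i b0, a_i v>], Young's inequality and [ca] give
     [2 |b0|^2 <= |b0|^2 + |v|^2]. *)
  have e1 : sqn b0 = \sum_i dot (a i *m b0) (a i *m v).
    rewrite /sqn {2}/b0 dot_sumr; apply: eq_bigr => i _.
    by rewrite dot_mull.
  have e2 : sqn b0 = \sum_i dot (a i *m v) (a i *m b0).
    rewrite [LHS]dot_conj -/(sqn b0) e1 rmorph_sum /=.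
    by apply: eq_bigr => i _; rewrite -dot_conj.
  rewrite -(lerD2l (sqn b0)) {1}e1 {1}e2 -big_split /=.
  apply: le_trans (lerD (ca _ b0) (ca _ v)).
  by rewrite -big_split /=; apply: ler_sum => i _; exact: dot_young.
(* Once the terms [i = j] are restored, [ca'] bounds the sum over [i] and [ca] the sum over [j]. *)
apply: le_trans (ca _ v).
apply: (@le_trans _ _ (\sum_(ij : I * I) sqn ((a ij.1)^t* *m (a ij.2 *m v)))).
  rewrite [leRHS](bigID (fun ij => ij.1 != ij.2)) /= lerDl.
  by apply: sumr_ge0 => ? _; exact: sqn_ge0.
rewrite -(pair_bigA _ (fun i j => sqn ((a i)^t* *m (a j *m v)))) exchange_big
  /=.
by apply: ler_sum => j _; exact: ca'.
Qed.
End RandomPhases.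

(* The integrated form of the scalar inequality
   [2 h / (1 + h) >= (3 h - h ^ 2) / 2], with [h] in place of [gram a]. *)
Lemma cay_overlap (C : numClosedFieldType) m p (a : 'M[C]_m) (v : 'M[C]_(m, p))
  :
  3 * sqn (a *m v) - sqn (gram a *m v) <= 2 * dot (a *m v) (cay a *m v).
Proof.
rewrite /cay -scalemxAl dotZr -mulmxA.
have [u -> ->] := gram_inv_vec a v.
set h := gram a.
have hC x y : dot (h *m x) y = dot x (h *m y) by rewrite dot_mull trmxC_gram.
have aE x y : dot (a *m x) (a *m y) = dot x (h *m y).
  by rewrite dot_mull /h /gram mulmxA.
rewrite -subr_ge0.
(* The scalar identity is [4 h (1 + h) - (3 h - h ^ 2) (1 + h) ^ 2 = h (1 - h) ^ 2 + h ^ 2 (1 - h) ^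
   2]. *)
apply: le_trans (addr_ge0 (sqn_ge0 (a *m (u - h *m u)))
                          (sqn_ge0 (h *m (u - h *m u)))) _.
rewrite /sqn !aE !hC !(mulmxDr, dotDl, dotDr, mulmxN, dotNl, dotNr, hC).
by apply: le_of_eq; ring.
Qed.

(** * Symmetries of the random phase matrix and of its truncation *)

Section RandomContraction.
Variables (C : numClosedFieldType) (n : nat).

Local Notation I := ('I_n * 'I_n)%type.
Local Notation Om := {ffun I -> 'Z_4}.
Implicit Types (w : Om) (i j k l : 'I_n).

(** The phases are conjugate to those of [phase_sum], so averaging a covariant entry against
    [phase_sum a] isolates one [a q]. *)
Definition phase_mx w : 'M[C]_n := \matrix_(i, j) phase C (- w) (i, j).

Definition row_bump k : Om := [ffun q => (q.1 == k)%:R].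
Definition col_bump l : Om := [ffun q => (q.2 == l)%:R].
Definition permute (s s' : 'S_n) w : Om := [ffun q => w (s q.1, s' q.2)].

(** Rotating a row or column of phases and permuting rows or columns are multiplications by
    unitaries, hence survive truncation. Rotations make distinct entries orthogonal; permutations
    give all entries equal moments. *)
Definition covariant (X : Om -> 'M[C]_n) :=
  [/\ forall k w i j,
        X (w + row_bump k) i j = (if i == k then - 'i else 1) * X w i j,
      forall l w i j,
        X (w + col_bump l) i j = (if j == l then - 'i else 1) * X w i j
    & forall s s' w i j, X (permute s s' w) i j = X w (s i) (s' j)].

Lemma phase_mx_covariant : covariant phase_mx.
Proof.
split=> [k w i j|l w i j|s s' w i j]; rewrite !mxE.
- rewrite phaseN phaseD rmorphM /= -phaseN mulrC; congr (_ * _).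
  by rewrite /phase ffunE /=; case: eqP => _;
    rewrite ?expr1 ?conjCi ?expr0 ?conjC1.
- rewrite phaseN phaseD rmorphM /= -phaseN mulrC; congr (_ * _).
  by rewrite /phase ffunE /=; case: eqP => _;
    rewrite ?expr1 ?conjCi ?expr0 ?conjC1.
- by rewrite /phase !ffunE.
Qed.

Lemma diag_unitary k :
  diag_mx (\row_i (if i == k then - 'i else 1 : C)) \is unitarymx.
Proof.
apply/unitarymxP; rewrite tr_diag_mx map_diag_mx.
apply/matrixP => i j; rewrite mul_diag_mx !mxE.
case: (eqVneq i j) => [->|]; last by rewrite mulr0n mulr0.
rewrite !mulr1n -normCK; case: ifP => _;
  rewrite ?normrN ?normCi ?normr1 expr1n //.
Qed.

Lemma perm_unitary (s : 'S_n) : (perm_mx s : 'M[C]_n) \is unitarymx.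
Proof.
apply/unitarymxP; rewrite tr_perm_mx map_perm_mx -perm_mxM mulgV.
exact: perm_mx1.
Qed.

Lemma cay_covariant (X : Om -> 'M[C]_n) (c : C) :
  covariant X -> covariant (fun w => cay (c *: X w)).
Proof.
have u1 : (1%:M : 'M[C]_n) \is unitarymx.
  by apply/unitarymxP; rewrite trmxC1 mulmx1.
case=> hr hc hp; split => [k w i j|l w i j|s s' w i j].
- have -> : c *: X (w + row_bump k)
      = diag_mx (\row_i (if i == k then - 'i else 1)) *m (c *: X w) *m 1%:M.
    apply/matrixP => i' j'; rewrite mulmx1 mul_diag_mx !mxE hr; ring.
  by rewrite cay_unitary ?diag_unitary // mulmx1 mul_diag_mx !mxE.
- have -> : c *: X (w + col_bump l)
      = 1%:M *m (c *: X w) *m diag_mx (\row_i (if i == l then - 'i else 1)).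
    apply/matrixP => i' j'; rewrite mul1mx mul_mx_diag !mxE hc; ring.
  by rewrite cay_unitary ?diag_unitary // mul1mx mul_mx_diag !mxE mulrC.
- have -> : c *: X (permute s s' w)
      = perm_mx s *m (c *: X w) *m perm_mx (s'^-1)%g.
    by rewrite -row_permE -col_permE; apply/matrixP => i' j'; rewrite !mxE hp.
  by rewrite cay_unitary ?perm_unitary // -row_permE -col_permE !mxE.
Qed.

(** Distinct positions differ in row or column, and rotating that row or column of [q] affects the
    factor from [X] only. *)
Lemma covariant_orth (X Y : Om -> 'M[C]_n) (q r : I) :
  covariant X -> covariant Y -> q != r ->
  \sum_w X w q.1 q.2 * (Y w r.1 r.2)^* = 0.
Proof.
case: q r => [i j] [i' j'] [Xr Xc _] [Yr Yc _] /=.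
rewrite xpair_eqE negb_and => /orP[ne|ne].
  apply: (sum_phase_eq0 (t := row_bump i) (c := - 'i)) => [w|].
    by rewrite Xr Yr eqxx eq_sym (negPf ne) mul1r mulrA.
  rewrite -conjCi.
  by apply: contra (imaginary_neq1 C) => /eqP h; rewrite -['i]conjCK h conjC1.
apply: (sum_phase_eq0 (t := col_bump j) (c := - 'i)) => [w|].
  by rewrite Xc Yc eqxx eq_sym (negPf ne) mul1r mulrA.
rewrite -conjCi.
by apply: contra (imaginary_neq1 C) => /eqP h; rewrite -['i]conjCK h conjC1.
Qed.

Lemma permute_bij (s s' : 'S_n) : bijective (permute s s').
Proof.
exists (permute (s^-1)%g (s'^-1)%g) => w; apply/ffunP => -[i j];
  rewrite !ffunE /=.
  by rewrite !permKV.
by rewrite !permK.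
Qed.

Lemma covariant_diag (X Y : Om -> 'M[C]_n) (q r : I) :
  covariant X -> covariant Y ->
  \sum_w X w q.1 q.2 * (Y w q.1 q.2)^* = \sum_w X w r.1 r.2 * (Y w r.1 r.2)^*.
Proof.
move=> [_ _ Xp] [_ _ Yp].
have b := permute_bij (tperm q.1 r.1) (tperm q.2 r.2).
rewrite (reindex _ (onW_bij _ b)) /=; apply: eq_bigr => w _.
by rewrite Xp Yp !tpermL.
Qed.
End RandomContraction.

(** * Moments of the truncated phase matrix *)

Lemma dotE (C : numClosedFieldType) m n (X Y : 'M[C]_(m, n)) :
  dot X Y = \sum_(q : 'I_m * 'I_n) Y q.1 q.2 * (X q.1 q.2)^*.
Proof.
rewrite -(pair_bigA _ (fun i j => Y i j * (X i j)^*)) exchange_big /dot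
  /mxtrace.
apply: eq_bigr => j _; rewrite mxE; apply: eq_bigr => i _.
by rewrite !mxE mulrC.
Qed.

Lemma sum_sqn_delta (C : numClosedFieldType) n p (v : 'M[C]_(n, p)) :
  \sum_(q : 'I_n * 'I_n) sqn (delta_mx q.1 q.2 *m v) = n%:R * sqn v.
Proof.
rewrite -(pair_bigA _ (fun k l => sqn (delta_mx k l *m v))) /=.
rewrite (eq_bigr (fun=> sqn v)) ?sumr_const ?card_ord ?mulr_natl // => k _ /=.
rewrite (sqnE v) [RHS]exchange_big; apply: eq_bigr => l _.
rewrite sqnE; apply: eq_bigr => j _.
have e i : (delta_mx k l *m v) i j = (i == k)%:R * v l j.
  rewrite mxE (bigD1 l) //= big1 ?addr0 => [|x xl].
    by rewrite mxE eqxx andbT.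
  by rewrite mxE (negPf xl) andbF mul0r.
rewrite (bigD1 k) //= big1 ?addr0 => [|i ik]; first by rewrite e eqxx mul1r.
by rewrite e (negPf ik) mul0r normr0 expr0n.
Qed.

(* [kappa = 1 / sqrt (2 n)] is the scale that maximises the lower bound for the
   overlap of [cay (kappa *: phase_mx w)] with [phase_mx w] obtained from second
   and fourth moments. *)
Section Truncation.
Variables (C : numClosedFieldType) (n : nat) (kappa : C).
Hypotheses (n0 : (0 < n)%N) (k0 : 0 < kappa) (kn : kappa ^+ 2 * (2 * n%:R) = 1).

Local Notation I := ('I_n * 'I_n)%type.
Local Notation Om := {ffun I -> 'Z_4}.
Local Notation N := (#|Om|%:R : C).
Implicit Types (w : Om).

Definition rand_cay w : 'M[C]_n := cay (kappa *: phase_mx C w).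

Lemma rand_cay_covariant : covariant rand_cay.
Proof. exact: cay_covariant (phase_mx_covariant C n). Qed.

Lemma card_Om_gt0 : 0 < N.
Proof. by rewrite ltr0n; apply/card_gt0P; exists 0. Qed.

(** By symmetry the [n] entries of a column have the same second moment, and a column of a
    contraction has norm at most 1. *)
Lemma rand_cay_var (q : I) : \sum_w `|rand_cay w q.1 q.2| ^+ 2 <= N / n%:R.
Proof.
have c := rand_cay_covariant.
rewrite ler_pdivlMr ?ltr0n //.
have -> : (\sum_w `|rand_cay w q.1 q.2| ^+ 2) * n%:R
    = \sum_w \sum_i `|rand_cay w i q.2| ^+ 2.
  rewrite exchange_big mulr_natr -[n in _ *+ n]card_ord -sumr_const.
  apply: eq_bigr => i _; rewrite !(eq_bigr _ (fun w _ => normCK _)).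
  exact: (covariant_diag q (i, q.2) c c).
rewrite -sum1_card natr_sum; apply: ler_sum => w _.
have -> : \sum_i `|rand_cay w i q.2| ^+ 2
  = sqn (rand_cay w *m delta_mx q.2 (ord0 : 'I_1)).
  by rewrite -colE sqnE big_ord1; apply: eq_bigr => i _; rewrite !mxE.
apply: le_trans (sqn_cay _ _) _; rewrite sqnE big_ord1.
rewrite (bigD1 q.2) //= big1 ?addr0 => [|i iq];
  first by rewrite mxE !eqxx normr1 expr1n.
by rewrite mxE (negPf iq) normr0 expr0n.
Qed.

Definition overlap (q : I) : C :=
  \sum_w rand_cay w q.1 q.2 * (phase_mx C w q.1 q.2)^*.

(** The bound [sum_sqn_gram] is applied to matrix units scaled by [nu = sqrt 2 kappa = 1 / sqrt n],
    the scale that makes them a contractive family. Returning from [nu] to [kappa] divides by 4. *)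
Lemma sum_sqn_gram_phase :
  \sum_w sqn (gram (kappa *: phase_mx C w) : 'M[C]_n) <= N * (n%:R / 2).
Proof.
pose nu : C := sqrtC 2 * kappa.
have nu_real : nu^* = nu by rewrite geC0_conj // mulr_ge0 ?sqrtC_ge0 ?ltW.
have nu2 : nu ^+ 2 = 2 * kappa ^+ 2 by rewrite exprMn sqrtCK.
pose E (q : I) : 'M[C]_n := nu *: delta_mx q.1 q.2.
have cE : contractive E /\ contractive (fun q => (E q)^t*).
  have nn : `|nu| ^+ 2 * n%:R = 1.
    by rewrite normCK nu_real -expr2 nu2 -[RHS]kn; ring.
  split=> p v.
    under eq_bigr do rewrite /E -scalemxAl sqnZ.
    by rewrite -mulr_sumr sum_sqn_delta mulrA nn mul1r.
  under eq_bigr do rewrite /E trmxCZ -scalemxAl sqnZ norm_conjC trmx_delta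
    map_delta_mx.
  rewrite -mulr_sumr (reindex (fun q : I => (q.2, q.1))) /=; last first.
    by exists (fun q : I => (q.2, q.1)) => -[].
  by rewrite sum_sqn_delta mulrA nn mul1r.
have ph w : phase_sum E w = nu *: phase_mx C (- w).
  rewrite /phase_sum /E [phase_mx _ _]matrix_sum_delta scaler_sumr.
  rewrite [RHS](eq_bigr (fun i => \sum_j phase C w (i, j) *: (nu
    *: delta_mx i j))).
    by rewrite pair_bigA; apply: eq_bigr => -[].
  move=> i _; rewrite scaler_sumr; apply: eq_bigr => j _.
  by rewrite mxE opprK !scalerA mulrC.
have := sum_sqn_gram (1%:M : 'M[C]_n) cE.1 cE.2; rewrite sqn1.
rewrite -sum_phaseN.
rewrite (eq_bigr (fun w => 4 * sqn (gram (kappa *: phase_mx C w) : 'M[C]_n))).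
  rewrite -mulr_sumr => h.
  rewrite -(ler_pM2l (_ : 0 < 4 :> C)) ?ltr0n //; apply: le_trans h _.
  by apply: le_of_eq; field.
move=> w _; rewrite ph opprK mulmx1 /gram !trmxCZ -!scalemxAl -!scalemxAr
  !scalerA.
rewrite nu_real (geC0_conj (ltW k0)) -!expr2 nu2 !sqnZ [RHS]mulrA;
  congr (_ * _).
rewrite normrM exprMn !ger0_norm ?exprn_ge0 ?ltW ?ltr0n //; ring.
Qed.

(** In the average of [cay_overlap] at [v = 1], the second moment equals [n / 2] and the fourth is
    at most [n / 2], so the left side is at least [n]. All [n ^ 2] overlaps agree, and
    [1 / (2 n kappa) = kappa]. *)
Lemma overlap_ge q : N * kappa <= overlap q.
Proof.
have c := rand_cay_covariant.
have kr : kappa^* = kappa by rewrite geC0_conj ?ltW.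
have nC : n%:R != 0 :> C by rewrite pnatr_eq0 -lt0n.
have k2 : kappa ^+ 2 = (2 * n%:R)^-1.
  by rewrite -[RHS]mul1r -[X in X * _]kn mulfK // mulf_neq0 // pnatr_eq0.
have sum_dot : \sum_w dot (kappa *: phase_mx C w) (rand_cay w)
    = kappa * n%:R ^+ 2 * overlap q.
  rewrite (eq_bigr (fun w => \sum_(r : I) kappa * (rand_cay w r.1 r.2 *
    (phase_mx C w r.1 r.2)^*))).
    rewrite exchange_big /= (eq_bigr (fun=> kappa * overlap q)).
      by rewrite sumr_const card_prod !card_ord -[LHS]mulr_natr natrM; ring.
    move=> r _; rewrite -mulr_sumr; congr (_ * _).
    exact: covariant_diag c (phase_mx_covariant C n).
  move=> w _; rewrite dotE; apply: eq_bigr => r _.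
  have -> : (kappa *: phase_mx C w) r.1 r.2 = kappa * phase_mx C w r.1 r.2.
    by rewrite mxE.
  by rewrite rmorphM /= kr; ring.
have sum_sqn : \sum_w sqn (kappa *: phase_mx C w : 'M[C]_n) = N * (n%:R / 2).
  rewrite (eq_bigr (fun=> n%:R / 2 : C)) => [|w _];
    first by rewrite sumr_const -[LHS]mulr_natl.
  rewrite sqnZ (ger0_norm (ltW k0)) k2 sqnE (eq_bigr (fun=> n%:R : C)).
    by rewrite sumr_const card_ord -mulr_natr; field.
  move=> j _; rewrite (eq_bigr (fun=> 1 : C)) ?sumr_const ?card_ord // => i _.
  by rewrite mxE norm_phase expr1n.
have : 3 * (N * (n%:R / 2)) - N * (n%:R / 2)
  <= 2 * (kappa * n%:R ^+ 2 * overlap q).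
  apply: le_trans (lerB (lexx _) sum_sqn_gram_phase) _.
  rewrite -sum_sqn -sum_dot !mulr_sumr -sumrB; apply: ler_sum => w _.
  by have := cay_overlap (kappa *: phase_mx C w) 1%:M; rewrite !mulmx1.
have -> : 3 * (N * (n%:R / 2)) - N * (n%:R / 2) = N * n%:R by field.
have -> : 2 * (kappa * n%:R ^+ 2 * overlap q) = kappa^-1 * n%:R * overlap q.
  have kx : kappa != 0 by rewrite gt_eqF.
  apply: (mulfI kx).
  transitivity (kappa ^+ 2 * (2 * n%:R) * (n%:R * overlap q)); first by ring.
  by rewrite kn; field.
rewrite -mulrA mulrCA [N * _]mulrC ler_pM2l ?ltr0n // => h.
by rewrite mulrC -(ler_pM2l (_ : 0 < kappa^-1)) ?invr_gt0 // mulKf ?gt_eqF.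
Qed.
End Truncation.

(** * One truncation step and its iteration *)

Section DualityStep.
Variables (C : numClosedFieldType) (n : nat) (kappa : C).
Hypotheses (n0 : (0 < n)%N) (k0 : 0 < kappa) (kn : kappa ^+ 2 * (2 * n%:R) = 1).

Local Notation I := ('I_n * 'I_n)%type.
Local Notation Om := {ffun I -> 'Z_4}.
Local Notation N := (#|Om|%:R : C).
Implicit Types (w : Om).

(** Halving makes [cay (2^-1 *: t)] agree with [t] to first order. *)
Definition resid m (t : 'M[C]_m) : 'M[C]_m := t - cay (2^-1 *: t).

(** The factor [1 / 8] is [2 / 16]: the moment bound 2, and [2^-1] to the fourth power from [gram]
    of a halved matrix inside [sqn]. *)
Lemma sum_sqn_resid m p (b : I -> 'M[C]_m) (v : 'M[C]_(m, p)) :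
  contractive b -> contractive (fun q => (b q)^t*) ->
  \sum_(w : Om) sqn (resid (phase_sum b w) *m v) <= N * (sqn v / 8).
Proof.
move=> cb cb'; apply: (@le_trans _ _ (\sum_(w : Om) 16^-1 * sqn (gram
  (phase_sum b w) *m v))).
  apply: ler_sum => w _; rewrite /resid.
  have two : 2 * 2^-1 = 1 :> C by rewrite mulfV // pnatr_eq0.
  have := sqn_cay_resid (2^-1 *: phase_sum b w) v.
  rewrite scalerA two scale1r => h; apply: le_trans h _.
  rewrite /gram trmxCZ -!scalemxAl -scalemxAr -scalemxAl scalerA sqnZ.
  apply: le_of_eq; congr (_ * _).
  by rewrite fmorphV /= conjC_nat normrM normfV normr_nat; field.
rewrite -mulr_sumr; apply: le_trans (ler_wpM2l _ (sum_sqn_gram v cb cb')) _.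
  by rewrite invr_ge0 ler0n.
by apply: le_of_eq; field.
Qed.

(** By [bessel] with constant [N / n] and [sum_sqn_resid], the total is at most
    [(4 / |A|^2) (N / n) (N / 8)] times [sqn v]. As [|A|^2 >= N ^ 2 / (2 n)], this is at most
    [sqn v], which is why the factor 2 is affordable. *)
Lemma contractive_resid m (phi : I -> Om -> C) (b : I -> 'M[C]_m) (A : C) :
  contractive b -> contractive (fun q => (b q)^t*) ->
  (forall q r, q != r -> \sum_w phi q w * (phi r w)^* = 0) ->
  (forall q, \sum_w `|phi q w| ^+ 2 <= N / n%:R) -> N * kappa <= `|A| ->
  contractive (fun q => (2 / A) *: \sum_w phi q w *: resid (phase_sum b w)).
Proof.
move=> cb cb' ho hv hA p v.
have N0 : 0 < N := card_Om_gt0 C n.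
have A0 : 0 < `|A| by apply: lt_le_trans hA; rewrite mulr_gt0.
have nC : n%:R != 0 :> C by rewrite pnatr_eq0 -lt0n.
under eq_bigr do rewrite -scalemxAl sqnZ mulmx_suml.
rewrite -mulr_sumr normrM normfV normr_nat.
have -> : (2 / `|A|) ^+ 2 = 4 / `|A| ^+ 2 by field; rewrite gt_eqF.
rewrite mulrAC ler_pdivrMr ?exprn_gt0 //.
under eq_bigr => q _ do under eq_bigr do rewrite -scalemxAl.
have Nn : 0 < N / n%:R by apply: divr_gt0; rewrite ?ltr0n ?card_Om_gt0 //;
  rewrite -(ltr0n C).
have h1 := bessel (fun w => resid (phase_sum b w) *m v) Nn ho hv.
have h2 := ler_wpM2l (ltW Nn) (sum_sqn_resid v cb cb').
apply: le_trans (ler_wpM2l _ (le_trans h1 h2)) _; first by rewrite ler0n.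
apply: (@le_trans _ _ (sqn v * (N * kappa) ^+ 2)); last first.
  apply: ler_wpM2l; first exact: sqn_ge0.
  by apply: lerXn2r => //; rewrite nnegrE ?mulr_ge0 ?ltW.
have -> : (N * kappa) ^+ 2
  = N ^+ 2 * (kappa ^+ 2 * (2 * n%:R)) / (2 * n%:R) by field.
rewrite kn; apply: le_of_eq; field; exact: nC.
Qed.

Lemma contractive_ext m (a b : I -> 'M[C]_m) :
  (forall q, a q = b q) -> contractive b -> contractive a.
Proof. by move=> e cb p v; under eq_bigr do rewrite e; exact: cb. Qed.

Definition pairing m (G a : I -> 'M[C]_m) : C := \sum_q \tr (G q *m a q).

Lemma phase_mxC w (q : I) : (phase_mx C w q.1 q.2)^* = phase C w q.
Proof. by rewrite mxE phaseN conjCK -surjective_pairing. Qed.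

Lemma overlap_expand m (a : I -> 'M[C]_m) (q : I) :
  \sum_w rand_cay kappa w q.1 q.2 *: phase_sum a w = overlap kappa q *: a q.
Proof.
have c : covariant (rand_cay (n := n) kappa) := rand_cay_covariant _ _.
under eq_bigr do rewrite /phase_sum scaler_sumr.
rewrite exchange_big (bigD1 q) //= [X in _ + X]big1 ?addr0.
  rewrite /overlap scaler_suml; apply: eq_bigr => w _; rewrite scalerA.
  by rewrite phase_mxC.
move=> r rq; transitivity ((\sum_w rand_cay kappa w q.1 q.2 * (phase_mx C w r.1
  r.2)^*) *: a r).
  rewrite scaler_suml; apply: eq_bigr => w _; rewrite scalerA.
  by rewrite phase_mxC.
by rewrite (covariant_orth c (phase_mx_covariant C n)) ?scale0r // eq_sym.
Qed.

(** By [overlap_expand], [a q] is [1 / A] times the sum of [rand_cay] entries against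
    [phase_sum a w]. Splitting [phase_sum a w] into its truncation and [resid] gives a part bounded
    through [hL] by [(N / A) L], and half of a new family [a']. *)
Lemma duality_step m (G a : I -> 'M[C]_m) (L : C) :
  (forall (x : 'M[C]_n) (y : 'M[C]_m),
      `|pairing G (fun q => cay x q.1 q.2 *: cay y)| <= L) ->
  contractive a -> contractive (fun q => (a q)^t*) ->
  exists a', [/\ contractive a', contractive (fun q => (a' q)^t*)
    & `|pairing G a| <= kappa^-1 * L + `|pairing G a'| / 2].
Proof.
move=> hL ca ca'.
have N0 : 0 < N := card_Om_gt0 C n.
have c : covariant (rand_cay (n := n) kappa) := rand_cay_covariant _ _.
pose q0 : I := (Ordinal n0, Ordinal n0); pose A := overlap kappa q0.
have hA : N * kappa <= A := overlap_ge n0 k0 kn q0.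
have A0 : 0 < A by apply: lt_le_trans hA; rewrite mulr_gt0.
have AE (q : I) : overlap kappa q = A.
  exact: covariant_diag c (phase_mx_covariant C n).
exists (fun q => (2 / A) *: \sum_w rand_cay kappa w q.1 q.2
  *: resid (phase_sum a w)).
split.
- apply: contractive_resid => //.
  + by move=> q r; exact: covariant_orth.
  + by move=> q; exact: rand_cay_var.
  + by rewrite ger0_norm // ltW.
(* The adjoint of the new family is the same construction for the adjoints of [a], with [w] replaced
   by [- w] and conjugate coefficients. *)
- have cc := contractive_resid (phi := fun q w => (rand_cay kappa (- w) q.1
  q.2)^*) (A := A^*) ca'.
  apply: contractive_ext (cc _ _ _ _); last 4 first.
  + by apply: contractive_ext ca => q; rewrite trmxCK.
  + move=> q r qr.
    pose f w := (rand_cay kappa w q.1 q.2)^* * ((rand_cay kappa w r.1 r.2)^*)^*.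
    have := congr1 Num.conj (covariant_orth c c qr).
    rewrite conjC0 rmorph_sum (sum_phaseN f) => h; rewrite -[RHS]h.
    by apply: eq_bigr => w _; rewrite rmorphM.
  + move=> q; apply: le_trans (rand_cay_var kappa n0 q).
    under eq_bigr do rewrite norm_conjC.
    by rewrite (sum_phaseN (fun w => `|rand_cay kappa w q.1 q.2| ^+ 2)).
  + by rewrite norm_conjC ger0_norm // ltW.
  move=> q; rewrite trmxCZ trmxC_sum -[in LHS]sum_phaseN rmorphM fmorphV /=
    conjC_nat /=.
  congr (_ *: _); apply: eq_bigr => w _; rewrite trmxCZ; congr (_ *: _).
  rewrite /resid trmxCD trmxCN trmxC_cay trmxCZ fmorphV /= conjC_nat.
  have -> // : (phase_sum a (- w))^t* = phase_sum (fun q => (a q)^t*) w.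
  rewrite /phase_sum trmxC_sum; apply: eq_bigr => r _.
  by rewrite trmxCZ phaseN conjCK.
set a' := fun q => _.
have -> : pairing G a
  = A^-1 * (\sum_w pairing G (fun q => rand_cay kappa w q.1 q.2 *: cay (2^-1
  *: phase_sum a w)))
     + pairing G a' / 2.
  pose S q := \sum_w rand_cay kappa w q.1 q.2 *: cay (2^-1 *: phase_sum a w).
  have -> : \sum_w pairing G (fun q => rand_cay kappa w q.1 q.2 *: cay (2^-1
    *: phase_sum a w)) = pairing G S.
    rewrite /pairing [LHS]exchange_big; apply: eq_bigr => q _ /=.
    by rewrite /S mulmx_sumr raddf_sum.
  rewrite /pairing mulr_sumr mulr_suml -big_split; apply: eq_bigr => q _ /=.
  rewrite -mxtraceZ mulrC -mxtraceZ -mxtraceD !scalemxAr -mulmxDr.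
  congr (\tr (_ *m _)); rewrite /a' scalerA.
  have -> : 2^-1 * (2 / A) = A^-1 by field; rewrite gt_eqF.
  rewrite -scalerDr /S -big_split /=.
  apply: (scalerI (lt0r_neq0 A0)); rewrite scalerA mulfV ?gt_eqF // scale1r.
  rewrite -(AE q) -overlap_expand; apply: eq_bigr => w _.
  by rewrite -scalerDr /resid addrC subrK.
apply: le_trans (ler_normD _ _) _; apply: lerD; last first.
  by rewrite normrM normfV normr_nat.
rewrite normrM normfV (ger0_norm (ltW A0)) ler_pdivrMl //.
apply: (@le_trans _ _ (N * L)).
  apply: le_trans (ler_norm_sum _ _ _) _.
  rewrite -sum1_card natr_sum mulr_suml; apply: ler_sum => w _.
  rewrite mul1r; exact: hL.
have L0 : 0 <= L by apply: le_trans (hL 0 0); exact: normr_ge0.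
rewrite mulrA; apply: ler_wpM2r => //.
by rewrite ler_pdivlMr.
Qed.

(** A crude a priori bound, from [|z| <= 1 + |z|^2] and [sqn (a q) <= m]; only its finiteness
    matters, since iteration divides it by powers of 2. *)
Definition entry_bound m (G : I -> 'M[C]_m) : C :=
  \sum_q \sum_i \sum_j `|G q i j| * (1 + m%:R).

Lemma pairing_bound m (G a : I -> 'M[C]_m) :
  contractive a -> `|pairing G a| <= entry_bound G.
Proof.
move=> ca; apply: le_trans (ler_norm_sum _ _ _) _; apply: ler_sum => q _.
apply: le_trans (ler_norm_sum _ _ _) _; apply: ler_sum => i _; rewrite mxE.
apply: le_trans (ler_norm_sum _ _ _) _; apply: ler_sum => j _; rewrite normrM.
apply: ler_wpM2l => //.
apply: (@le_trans _ _ (1 + `|a q j i| ^+ 2)).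
  have /orP[h|h] := real_leVge (normr_real (a q j i)) (real1 C).
    by apply: le_trans h _; rewrite lerDl exprn_ge0.
  by apply: (@le_trans _ _ (`|a q j i| ^+ 2)); rewrite ?lerDr // ler_eXnr.
rewrite lerD2l; apply: (@le_trans _ _ (sqn (a q *m 1%:M))).
  rewrite mulmx1 sqnE (bigD1 i) //= (bigD1 j) //= -addrA lerDl addr_ge0 //.
    by apply: sumr_ge0 => *; rewrite exprn_ge0.
  by do 2![apply: sumr_ge0 => * ]; rewrite exprn_ge0.
rewrite -(sqn1 C m); apply: le_trans (ca _ 1%:M).
by rewrite (bigD1 q) //= lerDl; apply: sumr_ge0 => *; exact: sqn_ge0.
Qed.

(** The main term is the fixed point of [y |-> kappa^-1 L + y / 2]. *)
Lemma pairing_iter m (G : I -> 'M[C]_m) (L : C) :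
  (forall (x : 'M[C]_n) (y : 'M[C]_m),
      `|pairing G (fun q => cay x q.1 q.2 *: cay y)| <= L) ->
  forall k (a : I -> 'M[C]_m),
  contractive a -> contractive (fun q => (a q)^t*) ->
  `|pairing G a| <= 2 * kappa^-1 * L + entry_bound G / 2 ^+ k.
Proof.
move=> hL; have L0 : 0 <= L by apply: le_trans (hL 0 0); exact: normr_ge0.
elim=> [|k IH] a ca ca'.
  rewrite expr0 divr1; apply: le_trans (pairing_bound G ca) _.
  by rewrite lerDr !mulr_ge0 // invr_ge0 ltW.
have [a' [h1 h2 h3]] := duality_step hL ca ca'.
apply: le_trans h3 _.
have := ler_wpM2r (_ : 0 <= 2^-1) (IH a' h1 h2).
rewrite invr_ge0 ler0n => /(_ isT) h.
apply: le_trans (lerD (lexx _) h) _.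
by rewrite exprS; apply: le_of_eq; field;
  rewrite expf_neq0 ?pnatr_eq0 // gt_eqF.
Qed.
End DualityStep.

(** * Block decomposition of operators on a tensor product *)

Section Blocks.
Variable C : numClosedFieldType.

(** Young's inequality in each semi-inner product given by [e i], applied to [conj(z i) s] and [v],
    sums to [2 |s|^2 <= |s|^2 + |v|^2]. *)
Lemma sqn_unimodular_measurement (K : finType) d p (e : K -> 'M[C]_d)
    (z : K -> C) (v : 'M[C]_(d, p)) :
  (forall i, (e i)^t* = e i) ->
  (forall i (u : 'M[C]_(d, p)), 0 <= dot u (e i *m u)) ->
  \sum_i e i = 1%:M -> (forall i, `|z i| = 1) ->
  sqn ((\sum_i z i *: e i) *m v) <= sqn v.
Proof.
move=> eh epos e1 z1; set s := _ *m v.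
have e2 : \sum_i dot s (e i *m v) * z i = sqn s.
  transitivity (dot s (\sum_i z i *: e i *m v)); last by rewrite -mulmx_suml.
  by rewrite dot_sumr; apply: eq_bigr => i _; rewrite -scalemxAl dotZr mulrC.
have dec (u : 'M[C]_(d, p)) : \sum_i dot u (e i *m u) = sqn u.
  by rewrite -dot_sumr -mulmx_suml e1 mul1mx.
have e3 : \sum_i (dot s (e i *m v) * z i)^* = sqn s.
  by rewrite -rmorph_sum e2 /= /sqn -dot_conj.
rewrite -(lerD2l (sqn s)) -{1}e2 -{1}e3 -(dec s) -(dec v) -!big_split /=.
apply: ler_sum => i _.
have := epos i ((z i)^* *: s - v).
rewrite mulmxBr -scalemxAr !dotDl !dotDr !dotNl !dotNr !dotZl !dotZr conjCK.
have -> : dot v (e i *m s) = (dot s (e i *m v))^*.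
  by rewrite -dot_conj dot_mull eh.
rewrite rmorphM mulrA -normCK z1 expr1n mul1r => h.
rewrite -subr_ge0; apply: le_trans h _; apply: le_of_eq; ring.
Qed.

(** For fixed [l], the blocks in column [l] contribute at most [sqn v]; the [n] columns are
    compensated by [|nu|^2 = 1 / n]. *)
Lemma contractive_block n d m (J : 'I_n -> 'M[C]_(d, m)) (nu : C)
    (s : 'M[C]_d) :
  (forall k, (J k)^t* *m J k = 1%:M) -> \sum_k J k *m (J k)^t* = 1%:M ->
  `|nu| ^+ 2 * n%:R = 1 ->
  (forall p (v : 'M[C]_(d, p)), sqn (s *m v) <= sqn v) ->
  contractive (fun q : 'I_n * 'I_n => nu *: ((J q.1)^t* *m s *m J q.2)).
Proof.
move=> J1 J2 hnu hs p v.
under eq_bigr do rewrite -scalemxAl sqnZ -!mulmxA.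
rewrite -mulr_sumr -(pair_bigA _ (fun k l => sqn ((J k)^t* *m (s *m (J l *m
  v))))) /=.
rewrite exchange_big /=.
have sumJ u : \sum_k sqn ((J k)^t* *m u) = sqn u :> C.
  transitivity (\sum_k dot u (J k *m (J k)^t* *m u)).
    by apply: eq_bigr => k _; rewrite /sqn dot_mull trmxCK mulmxA.
  by rewrite -dot_sumr -mulmx_suml J2 mul1mx.
rewrite -[leRHS]mul1r -[X in _ <= X * _]hnu -[leRHS]mulrA; apply: ler_wpM2l;
  first by rewrite exprn_ge0.
rewrite -[n in n%:R]card_ord -sum1_card natr_sum mulr_suml;
  apply: ler_sum => l _.
rewrite sumJ mul1r; apply: le_trans (hs _ _) _.
by rewrite /sqn dot_mull mulmxA J1 mul1mx.
Qed.

Lemma pairing_block n d m (J : 'I_n -> 'M[C]_(d, m)) (nu : C) (s x : 'M[C]_d) :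
  \sum_k J k *m (J k)^t* = 1%:M ->
  pairing (fun q : 'I_n * 'I_n => (J q.2)^t* *m x *m J q.1)
    (fun q => nu *: ((J q.1)^t* *m s *m J q.2)) = nu * \tr (s *m x).
Proof.
move=> J2; rewrite /pairing.
transitivity (\sum_l \sum_k nu * \tr (J k *m (J k)^t* *m (s *m (J l *m (J
  l)^t*) *m x))).
  rewrite -(pair_bigA _ (fun k l => \tr ((J l)^t* *m x *m J k *m (nu
    *: ((J k)^t* *m s *m J l))))) /=.
  rewrite [LHS]exchange_big /=; apply: eq_bigr => l _; apply: eq_bigr => k _.
  rewrite -scalemxAr mxtraceZ; congr (_ * _).
  by rewrite -!mulmxA [LHS]mxtrace_mulC -!mulmxA [LHS]mxtrace_mulC !mulmxA.
under eq_bigr => l _ do rewrite -mulr_sumr -raddf_sum -mulmx_suml J2 mul1mx.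
by rewrite -mulr_sumr -raddf_sum /= -mulmx_suml -mulmx_sumr J2 mulmx1.
Qed.

Lemma pairing_bilinear n m (I1 I2 : finType) (G : 'I_n * 'I_n -> 'M[C]_m)
    (z : I1 -> C) (P : I1 -> 'M[C]_n) (w : I2 -> C) (Q : I2 -> 'M[C]_m) :
  pairing G (fun q => (\sum_i z i *: P i) q.1 q.2 *: \sum_j w j *: Q j)
    = \sum_i \sum_j (z i * w j) * pairing G (fun q => P i q.1 q.2 *: Q j).
Proof.
transitivity (\sum_q \sum_i \sum_j (z i * w j) * \tr (G q *m (P i q.1 q.2
  *: Q j))).
  apply: eq_bigr => q _; rewrite summxE scaler_suml mulmx_sumr raddf_sum /=.
  apply: eq_bigr => i _; rewrite scaler_sumr mulmx_sumr raddf_sum /=.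
  apply: eq_bigr => j _; rewrite mxE -mxtraceZ scalemxAr !scalerA.
  by congr (\tr (_ *m (_ *: _))); ring.
rewrite [LHS]exchange_big; apply: eq_bigr => i _.
rewrite [LHS]exchange_big; apply: eq_bigr => j _.
by rewrite /pairing mulr_sumr.
Qed.

Section Embedding.
Variables (n m d : nat) (idx : 'I_n * 'I_m -> 'I_d).
Variable unidx : 'I_d -> 'I_n * 'I_m.
Hypotheses (idxK : cancel idx unidx) (unidxK : cancel unidx idx).

(** This is the isometry [v |-> e_k (x) v]. The bijection [idx] stays abstract so that either tensor
    factor can come first. *)
Definition emb (k : 'I_n) : 'M[C]_(d, m) := \matrix_(i, q) (i == idx (k, q))%:R.

Lemma embM p k (F : 'M[C]_(m, p)) i r :
  (emb k *m F) i r = ((unidx i).1 == k)%:R * F (unidx i).2 r.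
Proof.
rewrite mxE (bigD1 (unidx i).2) //= big1 ?addr0 => [|q qi].
  rewrite mxE -{1}(unidxK i) (can_eq idxK) {1}[unidx i]surjective_pairing
    xpair_eqE.
  by rewrite eqxx andbT.
rewrite mxE -{1}(unidxK i) (can_eq idxK) {1}[unidx i]surjective_pairing
  xpair_eqE.
by rewrite [_ == q]eq_sym (negPf qi) andbF mul0r.
Qed.

Lemma embC k : (emb k)^t* = (emb k)^T.
Proof. by apply/matrixP => i j; rewrite !mxE conjC_nat. Qed.

Lemma emb_sandwich k l (F : 'M[C]_m) i j :
  (emb k *m F *m (emb l)^t*) i j
    = ((unidx i).1 == k)%:R * ((unidx j).1 == l)%:R * F (unidx i).2 (unidx j).2.
Proof.
rewrite embC -[_ *m _]trmxK trmx_mul trmxK mxE embM mxE embM; ring.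
Qed.

Lemma emb_isometry k : (emb k)^t* *m emb k = 1%:M.
Proof.
rewrite embC; apply/matrixP => p r; rewrite !mxE (bigD1 (idx (k, p))) //=.
rewrite big1 ?addr0 => [|i ip].
  by rewrite !mxE eqxx mul1r (can_eq idxK) xpair_eqE eqxx.
by rewrite !mxE (negPf ip) mul0r.
Qed.

Lemma emb_complete : \sum_k emb k *m (emb k)^t* = 1%:M.
Proof.
apply/matrixP => i j; rewrite summxE (bigD1 (unidx i).1) //= big1 ?addr0.
  rewrite -[X in (X *m _) _ _]mulmx1 emb_sandwich eqxx mul1r !mxE -natrM mulnb.
  by rewrite [_.1 == _]eq_sym -xpair_eqE -!surjective_pairing (can_eq unidxK).
by move=> k ki; rewrite -[X in (X *m _) _ _]mulmx1 emb_sandwich eq_sym (negPf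
  ki) !mul0r.
Qed.

End Embedding.
End Blocks.

Local Open Scope complex_scope.

(** * From contractions to measurements over [R[i]] *)

Section Complex.
Variable R : realType.
Local Notation C := R[i].

Lemma norm_normc (z : C) : `|z| = (Normc.normc z)%:C.
Proof. by rewrite normc_def; case: z. Qed.

Lemma le_of_dyadic_error (x y B : C) : 0 <= x -> 0 <= y -> 0 <= B ->
  (forall k, x <= y + B / 2 ^+ k) -> x <= y.
Proof.
move=> /ger0_real /RRe_real <- /ger0_real /RRe_real <-.
move=> /[dup] B0 /ger0_real /RRe_real BE.
move: (complex.Re x) (complex.Re y) (complex.Re B) BE => {}x {}y b BE h.
move: B0; rewrite -BE ler0c => b0.
rewrite lecR leNgt; apply/negP => yx.
have d0 : 0 < x - y by rewrite subr_gt0.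
(* At this exponent the power of 2 exceeds [b / (x - y)], so the error is smaller than the gap. *)
have hb := upper_nthrootP (leqnn (Num.bound (b / (x - y)))).
have := h (Num.bound (b / (x - y))); set k := Num.bound _ in hb *.
have -> : B / 2 ^+ k = (b / 2 ^+ k)%:C.
  by rewrite -BE fmorph_div rmorphXn /= rmorph_nat.
rewrite -rmorphD lecR -lerBlDl ler_pdivlMr ?exprn_gt0 ?ltr0n // leNgt.
by rewrite mulrC -ltr_pdivrMr // hb.
Qed.

Lemma psd_herm d (e : 'M[C]_d) : psd e -> e^t* = e.
Proof. by case=> /is_hermitianmxP; rewrite expr0 scale1r => <-. Qed.

Lemma psd_dot d p (e : 'M[C]_d) (v : 'M[C]_(d, p)) : psd e ->
  0 <= dot v (e *m v).
Proof.
case=> _ h; rewrite /dot /mxtrace; apply: sumr_ge0 => j _.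
have := h (col j v).
suff -> : ((col j v)^t* *m e *m col j v) 0 0 = (v^t* *m (e *m v)) j j by [].
have e1 : e *m col j v = col j (e *m v) by rewrite !colE mulmxA.
rewrite -mulmxA e1 mxE [RHS]mxE.
by apply: eq_bigr => i _; rewrite !mxE.
Qed.

Lemma psd_outer d (B : 'rV[C]_d) : psd (B^t* *m B).
Proof.
split; first by apply/is_hermitianmxP; rewrite expr0 scale1r trmxCM trmxCK.
move=> v; have := sqn_ge0 (B *m v).
by rewrite /sqn /dot trmxCM !mulmxA /mxtrace big_ord1.
Qed.

Section Local.
Variables (n d m : nat) (J : 'I_n -> 'M[C]_(d, m)) (x : 'M[C]_d) (L : R).
Hypothesis n0 : (0 < n)%N.
Hypothesis J1 : forall k, (J k)^t* *m J k = 1%:M.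
Hypothesis J2 : \sum_k J k *m (J k)^t* = 1%:M.

(** The indices are exchanged so that pairing with the blocks of [s] yields [tr (s x)]. *)
Definition block_of (q : 'I_n * 'I_n) := (J q.2)^t* *m x *m J q.1.

Hypothesis hL : forall M1 M2 (P : 'I_M1 -> 'rV[C]_n) (Q : 'I_M2 -> 'rV[C]_m),
  \sum_i (P i)^t* *m P i = 1%:M -> \sum_j (Q j)^t* *m Q j = 1%:M ->
  \sum_i \sum_j
    `|pairing block_of (fun q => ((P i)^t* *m P i) q.1 q.2
      *: ((Q j)^t* *m Q j))|
      <= L%:C.

(** By [cay_measurement] both truncations are unimodular combinations of rank-one effects, the only
    ones that [hL] has to cover. *)
Lemma pairing_cay (a : 'M[C]_n) (b : 'M[C]_m) :
  `|pairing block_of (fun q => cay a q.1 q.2 *: cay b)| <= L%:C.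
Proof.
have [M1 [z [P [z1 P1 ->]]]] := cay_measurement a.
have [M2 [w [Q [w1 Q1 ->]]]] := cay_measurement b.
rewrite pairing_bilinear; apply: le_trans (hL P1 Q1).
apply: le_trans (ler_norm_sum _ _ _) _; apply: ler_sum => i _.
apply: le_trans (ler_norm_sum _ _ _) _; apply: ler_sum => j _.
by rewrite !normrM z1 w1 !mul1r.
Qed.

(** The constant is [nu^-1 * 2 kappa^-1 = sqrt n * 2 sqrt (2 n)]: scaling the blocks costs [sqrt n],
    the iteration the rest. *)
Lemma local_bound (s : 'M[C]_d) :
  (forall p (v : 'M[C]_(d, p)), sqn (s *m v) <= sqn v) ->
  (forall p (v : 'M[C]_(d, p)), sqn (s^t* *m v) <= sqn v) ->
  `|\tr (s *m x)| <= (2 * Num.sqrt 2 * n%:R * L)%:C.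
Proof.
move=> hs hs'.
have nR : 0 < n%:R :> R by rewrite ltr0n.
pose kr : R := (Num.sqrt (2 * n%:R))^-1; pose kappa : C := kr%:C.
pose nr : R := (Num.sqrt n%:R)^-1; pose nu : C := nr%:C.
have kr0 : 0 < kr by rewrite invr_gt0 sqrtr_gt0 mulr_gt0.
have nr0 : 0 < nr by rewrite invr_gt0 sqrtr_gt0.
have k0 : 0 < kappa by rewrite ltcR.
have nu0 : 0 < nu by rewrite ltcR.
have kn : kappa ^+ 2 * (2 * n%:R) = 1.
  have -> : kappa ^+ 2 * (2 * n%:R) = (kr ^+ 2 * (2 * n%:R))%:C.
    by rewrite !rmorphM /= !rmorph_nat.
  by rewrite exprVn sqr_sqrtr ?mulr_ge0 ?ltW // mulVf // gt_eqF // mulr_gt0.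
have hnu : `|nu| ^+ 2 * n%:R = 1.
  have -> : `|nu| ^+ 2 * n%:R = (nr ^+ 2 * n%:R)%:C.
    by rewrite (ger0_norm (ltW nu0)) !rmorphM /= !rmorph_nat.
  by rewrite exprVn sqr_sqrtr ?ltW // mulVf // gt_eqF.
pose a (q : 'I_n * 'I_n) := nu *: ((J q.1)^t* *m s *m J q.2).
have ca : contractive a by exact: contractive_block.
have ca' : contractive (fun q => (a q)^t*).
  move=> p v; have := contractive_block J1 J2 hnu hs' v.
  (* The adjoint of block [(k, l)] of [s] is block [(l, k)] of the adjoint of [s]. *)
  rewrite (reindex (fun q => (q.2, q.1))) /=;
    last by exists (fun q => (q.2, q.1)) => -[].
  apply: le_trans; apply: ler_sum => q _;
    rewrite /a trmxCZ !trmxCM trmxCK mulmxA.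
  by rewrite (geC0_conj (ltW nu0)).
have L0 : 0 <= L%:C by apply: le_trans (pairing_cay 0 0).
have EB0 : 0 <= entry_bound block_of.
  by do 3![apply: sumr_ge0 => * ]; rewrite mulr_ge0 // addr_ge0.
have Y0 : 0 <= 2 * kappa^-1 * L%:C by rewrite !mulr_ge0 // invr_ge0 ltW.
have := le_of_dyadic_error (normr_ge0 _) Y0 EB0 (fun k => pairing_iter n0 k0 kn
  pairing_cay k ca ca').
rewrite /a pairing_block // normrM => h.
rewrite (ger0_norm (ltW nu0)) -ler_pdivlMl // in h.
apply: le_trans h _.
have -> : nu^-1 * (2 * kappa^-1 * L%:C) = (nr^-1 * (2 * kr^-1 * L))%:C.
  by rewrite /nu /kappa !rmorphM /= !fmorphV /= rmorph_nat.
rewrite lecR !invrK sqrtrM //.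
have e : Num.sqrt n%:R * Num.sqrt n%:R = n%:R :> R.
  by rewrite -expr2 sqr_sqrtr // ltW.
by apply: le_of_eq; rewrite -[in RHS]e; ring.
Qed.
End Local.

Definition align (t : C) : C := if t == 0 then 1 else `|t| / t.

Lemma norm_align t : `|align t| = 1.
Proof.
rewrite /align; have [_|t0] := eqVneq t 0; first by rewrite normr1.
by rewrite normrM normfV normr_id divff // normr_eq0.
Qed.

Lemma alignM t : align t * t = `|t|.
Proof.
rewrite /align; have [->|t0] := eqVneq t 0; first by rewrite mulr0 normr0.
by rewrite mulfVK.
Qed.

(** With phases aligned to the traces, [sum z_i e_i] is a contraction whose trace against [x] is the
    whole sum. *)
Lemma measurement_bound d (x : 'M[C]_d) (e : opfamily R d) (B : C) :
  is_measurement e ->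
  (forall s : 'M[C]_d,
    (forall p (v : 'M[C]_(d, p)), sqn (s *m v) <= sqn v) ->
    (forall p (v : 'M[C]_(d, p)), sqn (s^t* *m v) <= sqn v) ->
    `|\tr (s *m x)| <= B) ->
  \sum_i `|\tr (e i *m x)| <= B.
Proof.
move=> [ep e1] hB.
pose z i := align (\tr (e i *m x)).
have z1 i : `|z i| = 1 by exact: norm_align.
have eh i : (e i)^t* = e i by apply: psd_herm.
have ed p i (v : 'M[C]_(d, p)) : 0 <= dot v (e i *m v) by apply: psd_dot.
have := hB (\sum_i z i *: e i).
have -> : \tr ((\sum_i z i *: e i) *m x) = \sum_i `|\tr (e i *m x)|.
  rewrite mulmx_suml raddf_sum; apply: eq_bigr => i _ /=.
  by rewrite -scalemxAl mxtraceZ alignM.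
rewrite ger0_norm ?sumr_ge0 //; apply.
  by move=> p v; exact: sqn_unimodular_measurement.
move=> p v; rewrite trmxC_sum; under eq_bigr do rewrite trmxCZ eh.
by apply: sqn_unimodular_measurement => // i; rewrite norm_conjC.
Qed.
End Complex.

(** * Comparison of the two distinguishability norms *)

Section Tensor.
Variable R : realType.
Local Notation C := R[i].

Lemma pairing_local n m d (idx : 'I_n * 'I_m -> 'I_d) unidx (x : 'M[C]_d)
    (E : 'M[C]_n) (F : 'M[C]_m) (T : 'M[C]_d) :
  cancel idx unidx -> cancel unidx idx ->
  (forall i j, T i j = E (unidx i).1 (unidx j).1 * F (unidx i).2 (unidx j).2) ->
  pairing (block_of (emb C idx) x) (fun q => E q.1 q.2 *: F) = \tr (T *m x).
Proof.
move=> idxK unidxK hT.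
have -> : T = \sum_q E q.1 q.2 *: (emb C idx q.1 *m F *m (emb C idx q.2)^t*).
  apply/matrixP => i j;
    rewrite hT summxE (bigD1 ((unidx i).1, (unidx j).1)) //=.
  rewrite big1 ?addr0 => [|[k l] kl].
    by rewrite mxE (emb_sandwich idxK unidxK) !eqxx !mul1r.
  rewrite mxE (emb_sandwich idxK unidxK) /=.
  move: kl; rewrite xpair_eqE negb_and ![k == _]eq_sym ![l == _]eq_sym.
  by case/orP => /negPf ->; rewrite !(mul0r, mulr0).
rewrite mulmx_suml raddf_sum; apply: eq_bigr => q _ /=.
rewrite /block_of -scalemxAr -scalemxAl !mxtraceZ; congr (_ * _).
by rewrite -!mulmxA mxtrace_mulC -!mulmxA mxtrace_mulC !mulmxA.
Qed.

(** The product [T] is abstract, so the same bound serves both orders of the factors; [n] is the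
    dimension of the factor carrying the matrix units. *)
Lemma ALL_le_local n m d (idx : 'I_n * 'I_m -> 'I_d) unidx (x : 'M[C]_d)
    (T : 'M[C]_n -> 'M[C]_m -> 'M[C]_d) (L : R) :
  (0 < n)%N -> cancel idx unidx -> cancel unidx idx ->
  (forall E F i j,
     T E F i j = E (unidx i).1 (unidx j).1 * F (unidx i).2 (unidx j).2) ->
  (forall (e : opfamily R n) (f : opfamily R m),
     is_measurement e -> is_measurement f ->
     \sum_i \sum_j Normc.normc (\tr (T (e i) (f j) *m x)) <= L) ->
  (dist_norm (@ALL R d) x <= (2 * Num.sqrt 2 * n%:R * L)%:E)%E.
Proof.
move=> n0 idxK unidxK hT hL; apply: ge_ereal_sup => _ [e [he ->]].
rewrite lee_fin -lecR rmorph_sum /=.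
under eq_bigr do rewrite -norm_normc.
apply: measurement_bound => // s hs hs'.
apply: (local_bound (J := emb C idx)) => //.
- exact: emb_isometry.
- exact: emb_complete.
- move=> M1 M2 P Q hP hQ.
  have mP : is_measurement (OpFamily (fun i => (P i)^t* *m P i)).
    by split=> // i; exact: psd_outer.
  have mQ : is_measurement (OpFamily (fun j => (Q j)^t* *m Q j)).
    by split=> // j; exact: psd_outer.
  have := hL _ _ mP mQ; rewrite -lecR rmorph_sum => h; apply: le_trans h.
  apply: ler_sum => i _; rewrite rmorph_sum; apply: ler_sum => j _ /=.
  by rewrite -norm_normc (pairing_local _ idxK unidxK (hT _ _)).
Qed.
End Tensor.

Theorem theorem1p1 (R : realType) (nA nB : nat)
    (hA : (1 <= nA)%N) (hB : (1 <= nB)%N) :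
  (data_hiding_ratio (@LO R nA nB)
     <= (2 * Num.sqrt 2 * (minn nA nB)%:R)%:E)%E.
Proof.
apply: ge_ereal_sup => _ [rho [sigma [p /= [_ _ _ _ ->]]]].
set x := _ - _; set S := dist_norm (@LO R nA nB) x; set K := 2 * _ * _.
have K0 : 0 <= K by rewrite !mulr_ge0 // sqrtr_ge0.
have sumS (e : opfamily R nA) (f : opfamily R nB) :
    is_measurement e -> is_measurement f ->
    ((\sum_i \sum_j Normc.normc (\tr ((e i *t f j) *m x)))%:E <= S)%E.
  move=> he hf; apply: ereal_sup_ubound; exists (tens_family e f).
  split; last by rewrite pair_bigA.
  by exists e, f.
(* The one-outcome measurement shows that the supremum [S] is over a nonempty set, hence
   nonnegative. *)
have trivial d : exists e : opfamily R d, is_measurement e.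
  exists (OpFamily (fun _ : unit => 1%:M)); split.
    move=> i; split; first exact: hermitian1mx_subproof.
    move=> v; have := sqn_ge0 v.
    by rewrite mulmx1 /sqn /dot /mxtrace big_ord1.
  by rewrite big_const card_unit /= addr0.
have S0 : (0 <= S)%E.
  have [e he] := trivial nA; have [f hf] := trivial nB.
  apply: le_trans (sumS e f he hf); rewrite lee_fin.
  by do 2![apply: sumr_ge0 => * ]; rewrite -ler0c -norm_normc.
have bound L : S = L%:E -> (dist_norm (@ALL R _) x <= (K * L)%:E)%E.
  move=> SL; rewrite /K; have [_|_] := leqP nA nB.
  - apply: (ALL_le_local (T := fun E F => E *t F) hA
             (@mxtens_indexK nA nB) (@mxtens_unindexK nA nB)).
      by move=> E F i j; rewrite mxE.
    by move=> e f he hf; rewrite -lee_fin -SL; exact: sumS.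
  (* Here [nB] is the smaller dimension, so the factors are exchanged. *)
  - pose unidx (i : 'I_(nA * nB)) :=
      ((mxtens_unindex i).2, (mxtens_unindex i).1).
    apply: (ALL_le_local (T := fun E F => F *t E) (unidx := unidx)
             (idx := fun q => mxtens_index (q.2, q.1)) hB).
    + by case=> k q; rewrite /unidx mxtens_indexK.
    + by move=> i; rewrite /unidx -surjective_pairing mxtens_unindexK.
    + by move=> E F i j; rewrite mxE mulrC.
    + move=> e f he hf; rewrite -lee_fin -SL exchange_big; exact: sumS.
(* The value [-oo] contradicts [S0]; at [+oo] the inverse, and so the ratio, is 0. *)
case: S S0 bound {sumS} => [L| |] // L0 bound;
  last by rewrite invey mule0 lee_fin.
have {}bound := bound _ erefl; rewrite inver; case: eqP => [L00|/eqP Ln0].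
  (* As [0^-1 = +oo], the ratio is bounded here because [bound] makes the numerator nonpositive. *)
  apply: (@le_trans _ _ 0%E); last by rewrite lee_fin.
  by rewrite mule_le0_ge0 //; apply: le_trans bound _; rewrite L00 mulr0.
rewrite lee_pdivrMr; last by rewrite lt_neqAle eq_sym Ln0 -lee_fin.
by rewrite -EFinM.
Qed.
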